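(* Let $\mathbb{F}$ be a finite field with $q$ elements, let $n\ge 1$, let $\delta,\gamma>0$, and let $K\subset\mathbb{F}^n$ be a $(\delta,\gamma)$-Kakeya set. Then \[ |K|\ge \binom{d+n-1}{n-1}, \qquad\text{where } d=\left\lfloor q\cdot\min\{\delta,\gamma\}\right\rfloor-2. \]
   Context: For $z,y\in\mathbb{F}^n$, the line through $z$ in direction $y$ is $L_{z,y}=\{z+a\cdot y: a\in\mathbb{F}\}$. A set $K\subset\mathbb{F}^n$ is a $(\delta,\gamma)$-Kakeya set if there exists a set $\mathcal{L}\subset\mathbb{F}^n$ with $|\mathcal{L}|\ge\delta\cdot q^n$ such that for every $y\in\mathcal{L}$ there is some $z\in\mathbb{F}^n$ for which the line $L_{z,y}$ intersects $K$ in at least $\gamma\cdot q$ points. *)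

(* Defs.v *)
From HB Require Import structures.
From mathcomp Require Import all_boot all_order all_algebra.
From mathcomp Require Import reals.

Set Implicit Arguments.
Unset Strict Implicit.
Unset Printing Implicit Defensive.

Import Order.TTheory GRing.Theory Num.Theory.
Local Open Scope ring_scope.

(* The direction y is allowed to be 0, in which case the line is the point z. *)
Definition line (F : finFieldType) (n : nat) (z y : 'rV[F]_n) : {set 'rV[F]_n} :=
  [set z + a *: y | a : F].

Definition kakeya_set (R : realType) (F : finFieldType) (n : nat)
    (delta gamma : R) (K : {set 'rV[F]_n}) : Prop :=
  exists2 L : {set 'rV[F]_n},
    delta * #|F|%:R ^+ n <= #|L|%:R
    & forall y, y \in L ->
      exists z : 'rV[F]_n, gamma * #|F|%:R <= #|line z y :&: K|%:R.

(* Binomial coefficient m (m - 1) ... (m - k + 1) / k! for an integer m of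
   either sign; it is 1 when k = 0, whatever m is. *)
Definition binz (m : int) (k : nat) : rat :=
  (\prod_(i < k) (m - i%:Z))%:~R / k`!%:R.

Lemma binz_nat (m k : nat) : binz m%:Z k = 'C(m, k)%:R.
Proof.
have k0 : k`!%:R != 0 :> rat by rewrite pnatr_eq0 -lt0n fact_gt0.
apply: (mulIf k0); rewrite divfK // -natrM bin_ffact.
suff -> : \prod_(i < k) (m%:Z - i%:Z) = (m ^_ k)%:Z by [].
elim: k {k0} => [|k IHk]; first by rewrite big_ord0 ffactn0.
rewrite big_ord_recr /= IHk ffactnSr PoszM.
have [lekm|ltmk] := leqP k m; first by rewrite subzn.
by rewrite ffact_small // !mul0r.
Qed.

(* Main.v *)
(* Dvir's polynomial method. If K had fewer points than there are monomials of
   degree d in n variables, some nonzero form P of degree d would vanish on K.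
   For a direction y whose line z + a y meets K in more than d points, the
   polynomial P(z + a y) in a has degree at most d and more than d roots, so its
   coefficient of degree d, which is P(y), vanishes. Hence P vanishes on all the
   directions, and these are too many for the Schwartz-Zippel lemma. *)
Require Import Defs.
From HB Require Import structures.
From mathcomp Require Import all_boot all_order all_algebra.
From mathcomp Require Import reals zify.

Set Implicit Arguments.
Unset Strict Implicit.
Unset Printing Implicit Defensive.

Import Order.TTheory GRing.Theory Num.Theory.
Local Open Scope ring_scope.

(* Polynomials are given by coefficients indexed by exponent vectors with entries
   less than D; the degree is bounded by hypotheses on the support. *)
Definition evalm (F : nzRingType) (n D : nat) (c : n.-tuple 'I_D -> F)
    (x : 'I_n -> F) : F :=
  \sum_t c t * \prod_i x i ^+ tnth t i.

Lemma big_tuple_cons (A : Type) (idx : A) (op : Monoid.com_law idx)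
    (T : finType) (n : nat) (f : n.+1.-tuple T -> A) :
  \big[op/idx]_t f t =
  \big[op/idx]_(a : T) \big[op/idx]_(t : n.-tuple T) f [tuple of a :: t].
Proof.
rewrite pair_bigA /= (reindex (fun p : T * n.-tuple T => [tuple of p.1 :: p.2])) //=.
exists (fun t => (thead t, [tuple of behead t])) => [[a t] _|t _] /=.
  by congr pair; apply/val_inj.
by rewrite [RHS]tuple_eta.
Qed.

(** Separating off the first variable prepares the induction on the number of variables. *)
Lemma evalm_cons (F : comNzRingType) (n D : nat) (c : n.+1.-tuple 'I_D -> F)
    (a : F) (x : n.-tuple F) :
  evalm c (tnth [tuple of a :: x]) =
  \sum_(j < D) evalm (fun t : n.-tuple 'I_D => c [tuple of j :: t]) (tnth x) * a ^+ j.
Proof.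
rewrite /evalm big_tuple_cons; apply: eq_bigr => j _.
rewrite mulr_suml; apply: eq_bigr => t _.
rewrite big_ord_recl !tnth0 -mulrA; congr (_ * _); rewrite mulrC; congr (_ * _).
by apply: eq_bigr => i _; rewrite !tnthS.
Qed.

Lemma card_poly_roots (F : finFieldType) (p : {poly F}) (m : nat) :
  p != 0 -> (size p <= m.+1)%N -> (#|[set a | root p a]| <= m)%N.
Proof.
move=> p0 sp; rewrite -ltnS; apply: leq_trans sp; rewrite cardE.
apply: max_poly_roots => //; last exact: enum_uniq.
by apply/allP => a; rewrite mem_enum inE.
Qed.

(** The zeros are counted fibre by fibre over the last variables. The factor [#|F|] on the left
    avoids the exponent [n - 1], so that the induction can start at [n = 0]. *)
Lemma schwartz_zippel (F : finFieldType) (n D k : nat)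
    (c : n.-tuple 'I_D -> F) (t0 : n.-tuple 'I_D) :
  c t0 != 0 ->
  (forall t, c t != 0 -> (\sum_(i < n) tnth t i <= k)%N) ->
  (#|[set x : n.-tuple F | evalm c (tnth x) == 0%R]| * #|F| <= k * #|F| ^ n)%N.
Proof.
elim: n k c t0 => [|n IHn] k c t0 ct0 degc.
  rewrite (_ : [set _ | _] = set0) ?cards0 //; apply/setP => x; rewrite !inE.
  rewrite /evalm (bigD1 t0) //= [X in _ + X]big1 => [|t]; last first.
    by rewrite (tuple0 t) [t0]tuple0 eqxx.
  by rewrite big_ord0 mulr1 addr0 (negPf ct0).
pose cj (j : 'I_D) (t : n.-tuple 'I_D) := c [tuple of j :: t].
pose Q := [pred j : 'I_D | [exists t, cj j t != 0]].
have Q0 : Q (thead t0).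
  by apply/existsP; exists [tuple of behead t0]; rewrite /cj -tuple_eta.
(* The induction is applied to the coefficient of the highest power of x_0. *)
have [j /existsP[t1 ct1] jmax] := arg_maxnP (fun j : 'I_D => j : nat) Q0.
have degj t : cj j t != 0 -> (\sum_(i < n) tnth t i <= k - j)%N.
  move=> /degc; rewrite big_ord_recl tnth0.
  under eq_bigr do rewrite tnthS.
  by move=> h; rewrite -(leq_add2l j) (leq_trans h) // -leq_subLR.
have lejk : (j <= k)%N.
  by move: (degc _ ct1); rewrite big_ord_recl tnth0; apply: leq_trans; rewrite leq_addr.
have cj0 (i : 'I_D) x : (j < i)%N -> evalm (cj i) x = 0.
  move=> ji; rewrite /evalm big1 // => t _; apply/eqP; rewrite mulf_eq0.
  apply/orP; left; apply: contraLR ji => cit; rewrite -leqNgt.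
  by apply: jmax; apply/existsP; exists t.
pose Zj := [set x : n.-tuple F | evalm (cj j) (tnth x) == 0].
have cardZ : #|[set x : n.+1.-tuple F | evalm c (tnth x) == 0%R]| =
    (\sum_(x : n.-tuple F) #|[set a : F | evalm c (tnth [tuple of a :: x]) == 0%R]|)%N.
  rewrite -sum1_card big_mkcond /=.
  under eq_bigr do rewrite inE.
  rewrite big_tuple_cons.
  rewrite exchange_big /=; apply: eq_bigr => x _.
  by rewrite -sum1_card [RHS]big_mkcond; apply: eq_bigr => a _; rewrite inE.
(* Where the leading coefficient vanishes, the whole fibre is allowed; elsewhere the fibre consists
   of the roots of a nonzero polynomial of degree at most [j]. *)
have fibre (x : n.-tuple F) :
    (#|[set a : F | evalm c (tnth [tuple of a :: x]) == 0%R]| <=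
      (x \in Zj) * #|F| + j)%N.
  rewrite inE; case: eqP => [_|/eqP Pj0]; first
    by rewrite mul1n (leq_trans (max_card _)) // leq_addr.
  rewrite add0n.
  pose p := \sum_(i < D) evalm (cj i) (tnth x) *: 'X^i.
  have pj : p`_j = evalm (cj j) (tnth x).
    rewrite coef_sum (bigD1 j) //= coefZ coefXn eqxx mulr1 big1 ?addr0 // => i ij.
    by rewrite coefZ coefXn eq_sym (negPf (_ : i != j :> nat)) ?mulr0.
  rewrite (_ : [set a | _] = [set a | root p a]); last first.
    apply/setP => a; rewrite !inE evalm_cons.
    rewrite rootE horner_sum; congr (_ == _); apply: eq_bigr => i _.
    by rewrite hornerZ hornerXn.
  apply: card_poly_roots; first by apply: contraNneq Pj0 => p0; rewrite -pj p0 coef0.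
  apply/leq_sizeP => m jm; rewrite coef_sum big1 // => i _.
  rewrite coefZ coefXn; case: eqP => [mi|_]; last by rewrite mulr0.
  by rewrite cj0 ?mul0r // -mi.
have := IHn (k - j)%N (cj j) t1 ct1 degj; rewrite -/Zj => IH.
rewrite cardZ expnSr mulnA leq_mul2r; apply/orP; right.
(* With q = [#|F|], the sum is |Zj| q + j q^n, and the induction hypothesis bounds |Zj| q by (k - j)
   q^n. *)
apply: (@leq_trans (\sum_(x : n.-tuple F) ((x \in Zj) * #|F| + j))%N).
  by apply: leq_sum => x _; apply: fibre.
rewrite big_split /= -big_distrl /= sum_nat_const card_tuple.
rewrite -[X in (_ <= X * _)%N](subnK lejk) mulnDl [(j * _)%N]mulnC leq_add2r.
apply: leq_trans IH; rewrite leq_mul2r -sum1_card [X in (_ <= X)%N]big_mkcond /=.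
by apply/orP; right; apply: leq_sum => x _; case: (x \in Zj).
Qed.

(** Every other term of the convolution has a factor beyond its size bound. Bounds replace exact
    degrees because the factors z_i + y_i X used below become constant when y_i = 0. *)
Lemma top_coefM (F : nzRingType) (a b : nat) (p q : {poly F}) :
  (size p <= a.+1)%N -> (size q <= b.+1)%N ->
  (size (p * q)%R <= (a + b).+1)%N /\ (p * q)`_(a + b) = p`_a * q`_b.
Proof.
move=> sp sq; split.
  apply: leq_trans (size_polyMleq _ _) _; rewrite -subn1 leq_subLR.
  by apply: leq_trans (leq_add sp sq) _; rewrite addSn addnS.
have la : (a < (a + b).+1)%N by rewrite ltnS leq_addr.
rewrite coefM (bigD1 (Ordinal la)) //= addKn big1 ?addr0 // => i.
rewrite -val_eqE /= neq_ltn => /orP[ia|ai].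
  rewrite [q`__]nth_default ?mulr0 //; apply: leq_trans sq _.
  by rewrite ltn_subRL ltn_add2r.
by rewrite [p`__]nth_default ?mul0r //; apply: leq_trans sp _.
Qed.

Lemma top_coef_exp (F : nzRingType) (a k : nat) (p : {poly F}) :
  (size p <= a.+1)%N ->
  (size (p ^+ k)%R <= (k * a).+1)%N /\ (p ^+ k)`_(k * a) = p`_a ^+ k.
Proof.
move=> sp; elim: k => [|k [IHs IHc]]; first by rewrite !expr0 size_poly1 coef1.
by rewrite !exprS mulSn -IHc; apply: top_coefM.
Qed.

Lemma top_coef_prod (F : nzRingType) (n : nat) (e : 'I_n -> nat)
    (p : 'I_n -> {poly F}) :
  (forall i, size (p i) <= (e i).+1)%N ->
  (size (\prod_i p i)%R <= (\sum_i e i).+1)%N /\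
  (\prod_i p i)`_(\sum_i e i) = \prod_i (p i)`_(e i).
Proof.
elim: n e p => [|n IHn] e p sp; first by rewrite !big_ord0 size_poly1 coef1.
have [|IHs IHc] := IHn (e \o lift ord0) (p \o lift ord0).
  by move=> i; apply: sp.
by rewrite !big_ord_recl -IHc; apply: top_coefM.
Qed.

Lemma evalm_line_roots (F : finFieldType) (n D d : nat)
    (c : n.-tuple 'I_D -> F) (z y : 'I_n -> F) :
  (forall t, c t != 0 -> (\sum_(i < n) tnth t i)%N = d) ->
  evalm c y != 0 ->
  (#|[set a : F | evalm c (fun i => (z i + a * y i)%R) == 0%R]| <= d)%N.
Proof.
move=> homc cy.
pose m (t : n.-tuple 'I_D) := \prod_i ((z i)%:P + y i *: 'X) ^+ tnth t i.
pose p := \sum_t c t *: m t.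
have topm t : c t != 0 ->
    (size (m t) <= d.+1)%N /\ (m t)`_d = \prod_i y i ^+ tnth t i.
  move=> /homc <-.
  have top i : (size (((z i)%:P + y i *: 'X) ^+ tnth t i)%R <= (tnth t i).+1)%N /\
      (((z i)%:P + y i *: 'X) ^+ tnth t i)`_(tnth t i) = y i ^+ tnth t i.
    have := @top_coef_exp F 1 (tnth t i) ((z i)%:P + y i *: 'X).
    rewrite muln1 coefD coefC coefZ coefX mulr1 add0r; apply.
    rewrite (leq_trans (size_polyD _ _)) // geq_max.
    rewrite (leq_trans (size_polyC_leq1 _)) //.
    by rewrite (leq_trans (size_scale_leq _ _)) // size_polyX.
  have [sm ->] := top_coef_prod (fun i => (top i).1).
  by split=> //; apply: eq_bigr => i _; rewrite (top i).2.
(* The constants z_i affect only lower powers of X, so a monomial of degree [d] contributes exactly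
   its value at [y]. *)
have pd : p`_d = evalm c y.
  rewrite coef_sum; apply: eq_bigr => t _; rewrite coefZ.
  by have [->|/topm[_ ->]] := eqVneq (c t) 0; rewrite ?mul0r.
rewrite (_ : [set a | _] = [set a | root p a]); last first.
  apply/setP => a; rewrite !inE rootE horner_sum; congr (_ == _).
  apply: eq_bigr => t _; rewrite hornerZ horner_prod; congr (_ * _).
  by apply: eq_bigr => i _; rewrite horner_exp hornerD hornerC hornerZ hornerX mulrC.
apply: card_poly_roots; first by apply: contraNneq cy => p0; rewrite -pd p0 coef0.
apply: leq_trans (size_sum _ _ _) _; apply/bigmax_leqP => t _.
have [->|/topm[sm _]] := eqVneq (c t) 0; first by rewrite scale0r size_poly0.
exact: leq_trans (size_scale_leq _ _) sm.
Qed.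

(** Vanishing on [K] imposes [#|K|] homogeneous linear equations on [#|S|] unknown coefficients; a
    nonzero vector in the left kernel of [M] solves them. *)
Lemma exists_form_vanishing (F : fieldType) (n D : nat) (X : finType)
    (S : {set n.-tuple 'I_D}) (K : {set X}) (v : X -> 'I_n -> F) :
  (#|K| < #|S|)%N ->
  exists c : n.-tuple 'I_D -> F,
    [/\ exists t, c t != 0, forall t, c t != 0 -> t \in S
      & forall x, x \in K -> evalm c (v x) = 0].
Proof.
move=> ltKS.
pose M := \matrix_(i < #|S|, j < #|K|)
  \prod_l v (enum_val j) l ^+ tnth (enum_val i) l.
have : kermx M != 0.
  rewrite kermx_eq0 /row_free neq_ltn; apply/orP; left.
  exact: leq_ltn_trans (rank_leq_col M) ltKS.
case/rowV0Pn => u /sub_kermxP uM /rV0Pn[i0 ui0].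
(* This is [u] extended by zero outside [S]: the sum has at most one term. *)
pose c (t : n.-tuple 'I_D) := \sum_(i < #|S| | enum_val i == t) u 0 i.
have cE i : c (enum_val i) = u 0 i.
  by rewrite /c (big_pred1 i) // => j; rewrite (inj_eq enum_val_inj).
exists c; split=> [|t|x xK].
- by exists (enum_val i0); rewrite cE.
- apply: contraR => tS; rewrite /c big1 // => i /eqP ti.
  by rewrite -ti enum_valP in tS.
have /rowP/(_ (enum_rank_in xK x)) := uM; rewrite !mxE => <-.
rewrite /evalm; under eq_bigr do rewrite mulr_suml.
rewrite (exchange_big_dep predT) //=; apply: eq_bigr => i _.
rewrite (big_pred1 (enum_val i)) => [|t]; last by rewrite eq_sym.
by rewrite mxE enum_rankK_in.
Qed.

Lemma kakeya_card_bound (F : finFieldType) (n d : nat)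
    (K L : {set 'rV[F]_n.+1}) :
  (d * #|F| ^ n.+1 < #|L| * #|F|)%N ->
  (forall y, y \in L -> exists z, (d < #|line z y :&: K|)%N) ->
  ('C(d + n, n) <= #|K|)%N.
Proof.
move=> bigL lineL; rewrite leqNgt; apply/negP.
(* The binomial counts the exponent vectors of length [n.+1] with sum [d]; their entries are at most
   [d], so [D] is [d.+1]. *)
rewrite addnC -card_ord_partitions.
move=> /(exists_form_vanishing (fun x : 'rV[F]_n.+1 => x 0)).
case=> c [[t0 ct0] suppc cK].
have homc t : c t != 0 -> (\sum_(i < n.+1) tnth t i)%N = d.
  by move=> /suppc; rewrite inE big_tuple => /eqP.
move: bigL; apply/negP; rewrite -leqNgt.
apply: leq_trans (schwartz_zippel (k := d) ct0 _); last by move=> t /homc ->.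
rewrite leq_mul2r; apply/orP; right.
pose f (y : 'rV[F]_n.+1) := [tuple y 0 i | i < n.+1].
have f_inj : injective f.
  move=> x y xy; apply/rowP => i.
  by have := congr1 (fun t => tnth t i) xy; rewrite !tnth_mktuple.
rewrite -(card_imset _ f_inj); apply/subset_leq_card/subsetP => _ /imsetP[y yL ->].
rewrite inE; have -> : evalm c (tnth (f y)) = evalm c (y 0).
  apply: eq_bigr => t _; congr (_ * _).
  by apply: eq_bigr => i _; rewrite tnth_mktuple.
have [z] := lineL y yL; apply: contraTT => cy; rewrite -leqNgt.
apply: leq_trans (evalm_line_roots (z 0) homc cy).
(* Points on the line are counted through their parameters [a], which also covers [y = 0]. *)
apply: leq_trans (leq_imset_card (fun a => z + a *: y) _).
apply/subset_leq_card/subsetP => x; rewrite inE => /andP[/imsetP[a _ ->] zK].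
apply/imsetP; exists a => //; rewrite inE -(cK _ zK); apply/eqP.
apply: eq_bigr => t _; congr (_ * _).
by apply: eq_bigr => i _; rewrite !mxE.
Qed.

Theorem theorem3 (R : realType) (F : finFieldType) (n : nat) (n_ge1 : (1 <= n)%N)
    (delta gamma : R) (delta_gt0 : 0 < delta) (gamma_gt0 : 0 < gamma)
    (K : {set 'rV[F]_n}) (kakeyaK : kakeya_set delta gamma K) :
  let d : int := Num.floor (#|F|%:R * Num.min delta gamma) - 2 in
  binz (d + n%:Z - 1) n.-1 <= #|K|%:R.
Proof.
case: n n_ge1 K kakeyaK => // n _ K [L cardL lineL] /=.
have q0 : 0 < #|F|%:R :> R by rewrite ltr0n; apply/card_gt0P; exists 0.
have min0 : 0 <= #|F|%:R * Num.min delta gamma by rewrite mulr_ge0 // le_min !ltW.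
move: (floor_le (#|F|%:R * Num.min delta gamma)).
move: min0; rewrite -floor_ge0; case: (Num.floor _) => // m _ /= mle.
have mdelta : m%:R <= #|F|%:R * delta.
  by apply: le_trans mle _; rewrite ler_pM2l // ge_min lexx.
have mgamma : m%:R <= gamma * #|F|%:R.
  by rewrite mulrC; apply: le_trans mle _; rewrite ler_pM2l // ge_min lexx orbT.
(* For [m < 2] the degree [m - 2] is negative. In dimension 1 the binomial is 1 and [K] is nonempty;
   in higher dimensions it is 0, except that it is -1 for [m = 0] in dimension 2. *)
have [m_ge2|m_lt2] := leqP 2 m; last first.
  have K_gt0 : (0 < #|K|)%N.
    have : 0 < #|L|%:R :> R.
      by apply: lt_le_trans cardL; rewrite mulr_gt0 // exprn_gt0.
    rewrite ltr0n => /card_gt0P[y /lineL[z zK]].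
    have : 0 < #|line z y :&: K|%:R :> R.
      by apply: lt_le_trans zK; rewrite mulr_gt0.
    by rewrite ltr0n => /leq_trans; apply; apply: subset_leq_card; apply: subsetIr.
  case: n K L cardL lineL K_gt0 => [|n] K _ _ _ K_gt0.
    by rewrite /binz big_ord0 divr1 ler1n.
  have [mn0|mn_gt0] := posnP (m + n).
    have [m0 n0] : m = 0%N /\ n = 0%N by lia.
    subst m n.
    by rewrite /binz big_ord1 /= divr1 (le_trans _ (ler0n _ _)).
  have -> : m%:Z - 2 + n.+2%:Z - 1 = (m + n).-1%:Z by lia.
  by rewrite binz_nat bin_small ?ler0n //; lia.
have -> : m%:Z - 2 + n.+1%:Z - 1 = (m - 2 + n)%N%:Z by lia.
(* The degree is [m - 2], and both strict inequalities follow from bounds with [m] in its place: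
   [mdelta] gives the one on [L], [mgamma] the one on the lines. *)
rewrite binz_nat ler_nat; apply: (kakeya_card_bound (L := L)) => [|y /lineL[z zK]].
  have : (m * #|F| ^ n.+1 <= #|L| * #|F|)%N.
    rewrite -(ler_nat R) !natrM natrX.
    apply: le_trans (_ : #|F|%:R * delta * #|F|%:R ^+ n.+1 <= _).
      by rewrite ler_pM2r ?exprn_gt0.
    by rewrite -mulrA mulrC ler_pM2r.
  by apply: leq_trans; rewrite ltn_pmul2r ?expn_gt0 -?(ltr0n R) ?q0 //; lia.
exists z; have : (m <= #|line z y :&: K|)%N by rewrite -(ler_nat R) (le_trans mgamma).
by apply: leq_trans; lia.
Qed.
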